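(* Let $f$ be a convex function from an interval $I\subseteq\mathbb{R}$ to $\mathbb{R}$. Let $x_1,x_2,\ldots,x_n$ be finitely many points from $I$. Extend the indices in $x_1,\ldots,x_n$ cyclically modulo $n$: for any integer $i\notin\{1,2,\ldots,n\}$, define $x_i=x_j$, where $j$ is the integer from $\{1,2,\ldots,n\}$ such that $i\equiv j \bmod n$. Let $x=\frac{x_1+x_2+\cdots+x_n}{n}$. Let $r$ be an integer. Then $$2\sum_{i=1}^n f(x_i) + n(n-2) f(x) \geq n\sum_{s=1}^n f\left(x+\frac{x_s-x_{s+r}}{n}\right).$$ *)

(* Defs.v *)
From mathcomp Require Import all_boot all_order all_algebra.
From mathcomp Require Import classical_sets reals normedtype convex.

Set Implicit Arguments.
Unset Strict Implicit.
Unset Printing Implicit Defensive.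

Import Order.TTheory GRing.Theory Num.Theory.

Local Open Scope ring_scope.

(* The points x_1, ..., x_n are the entries of the tuple x in this order, so
   that x_j is entry j - 1.  For i : int, the index j in {1, ..., n} congruent
   to i modulo n is ((i - 1) mod n) + 1, as the remainder of %%Z by n > 0 lies
   in {0, ..., n - 1}, also for negative dividends.  The default value 0 of nth
   is only reached when n = 0. *)
Definition cyclic_ext (R : realType) (n : nat) (x : n.-tuple R) (i : int) : R :=
  nth 0 x `|((i - 1) %% n%:Z)%Z|%N.

(* Main.v *)
(** By Karamata's method, an inequality [0 <= \sum_k w_k f(z_k)] between values of
    a convex function follows from the affine case and the cases
    [f(z) = |z - t|], because on a finite set [f] agrees with an affine function
    plus a nonnegative combination of such absolute values.  For
    [f(z) = |z - t|], put [y_i = x_i - t] and [S = \sum_i y_i]; the claim becomes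
      [\sum_s |S + y_s - y_(s+r)| <= 2 \sum_i |y_i| + (n - 2) |S|],
    which follows from the triangle inequality
    [|S + y_s - y_(s+r)| <= |y_s| + |S - y_(s+r)|] and the absolute value case
    [\sum_i |S - y_i| <= \sum_i |y_i| + (n - 2) |S|] of Popoviciu's inequality. *)

Require Import Defs.
From mathcomp Require Import all_boot all_order all_algebra.
From mathcomp Require Import classical_sets reals normedtype convex.
From mathcomp Require Import interval_inference zify ring lra.

Import Order.TTheory GRing.Theory Num.Theory.

Local Open Scope ring_scope.

(** * Popoviciu's inequality for the absolute value *)

(** Adding one term at a time: if both positive parts on the left are nonzero, [d] is subtracted
    twice there and only once on the right. *)
Lemma sum_max0_sub_le (R : realDomainType) (d : R) (s : seq R) : 0 <= d ->
  \sum_(y <- s) Num.max 0 (y - d)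
    <= Num.max 0 (\sum_(y <- s) Num.max 0 y - d).
Proof.
move=> d_ge0; elim: s => [|y s IH]; first by rewrite !big_nil le_max lexx.
rewrite !big_cons; apply: le_trans (lerD (lexx _) IH) _.
have : 0 <= \sum_(z <- s) Num.max 0 z.
  by apply: sumr_ge0 => z _; rewrite le_max lexx.
move: (\sum_(z <- s) _) => P P_ge0.
by case: (lerP 0 (y - d)); case: (lerP 0 y); case: (lerP 0 (P - d));
  case: (lerP 0 (_ + P - d)) => *; lra.
Qed.

Lemma normr_max0 (R : realDomainType) (u : R) : `|u| = 2 * Num.max 0 u - u.
Proof. by case: (ger0P u) => ?; lra. Qed.

(** Negating all entries changes neither side, so [0 <= S] may be assumed. Substituting
    [|u| = 2 * Num.max 0 u - u] then reduces the claim to the previous bound at [d = S], whose outer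
    maximum drops because [S] is at most the sum of the positive parts. *)
Lemma sum_norm_total_sub_le (R : realDomainType) (s : seq R) :
  let S := \sum_(y <- s) y in
  \sum_(y <- s) `|S - y| <= \sum_(y <- s) `|y| + ((size s)%:R - 2) * `|S|.
Proof.
cbv zeta; set S := \sum_(y <- s) y.
wlog S_ge0 : s @S / 0 <= S => [hwlog|].
  case: (leP 0 S) => [S_ge0|S_lt0]; first exact: hwlog.
  have := hwlog [seq - y | y <- s].
  rewrite /= !big_map size_map sumrN normrN oppr_ge0 (ltW S_lt0).
  move=> /(_ isT); rewrite -/S.
  rewrite [X in X <= _](eq_bigr (fun y => `|S - y|)); last first.
    by move=> y _; rewrite -[RHS]normrN opprB opprK addrC.
  by rewrite [X in _ <= X + _](eq_bigr (fun y => `|y|)) // => y _;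
    rewrite normrN.
have sumE : \sum_(y <- s) `|S - y|
    = 2 * \sum_(y <- s) Num.max 0 (y - S) - S + (size s)%:R * S.
  rewrite (eq_bigr (fun y => 2 * Num.max 0 (y - S) - y + S)).
    by rewrite !big_split /= -mulr_sumr sumrN -/S big_const_seq count_predT
      iter_addr_0 -[S *+ _]mulr_natl.
  by move=> y _; rewrite distrC normr_max0; ring.
have sumE0 : \sum_(y <- s) `|y| = 2 * \sum_(y <- s) Num.max 0 y - S.
  rewrite (eq_bigr (fun y => 2 * Num.max 0 y - y)).
    by rewrite big_split /= -mulr_sumr sumrN.
  by move=> y _; rewrite normr_max0.
have S_le : S <= \sum_(y <- s) Num.max 0 y.
  by apply: ler_sum => y _; rewrite le_max lexx orbT.
have := sum_max0_sub_le R S s S_ge0.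
rewrite max_r ?subr_ge0 // sumE sumE0 (ger0_norm S_ge0) mulrBl.
move: (_%:R * S) => nS; lra.
Qed.

(** * Piecewise affine interpolation of convex functions *)

Section ConvexSums.
Variables (R : realType) (I : set R) (f : R -> R).
Hypothesis f_convex : @convex_function R R^o I f.

Lemma convex_function_three_points (a b c : R) : I a -> I c -> a < b -> b < c ->
  (c - a) * f b <= (c - b) * f a + (b - a) * f c.
Proof.
move=> Ia Ic ab bc.
have ca : 0 < c - a by lra.
have t01 : 0 <= (c - b) / (c - a) <= 1.
  by rewrite divr_ge0 ?ler_pdivrMr //=; lra.
have := f_convex (Itv01 (andP t01).1 (andP t01).2) a c.
rewrite !inE => /(_ Ia Ic); rewrite !convRE /= /unstable.onem.
have cvxE : (c - b) / (c - a) * a + (1 - (c - b) / (c - a)) * c = b.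
  by field; rewrite gt_eqF.
rewrite [X in f X <= _](cvxE : _ = b).
rewrite -(ler_pM2l ca); congr (_ <= _).
by field; rewrite gt_eqF.
Qed.

(* The leftmost segment of the interpolant is described explicitly, as it is
   the one bent at [z] when a further point is added on the left. *)
Lemma convex_path_interpolation (y z : R) (s : seq R) :
  path <%R y (z :: s) -> {in y :: z :: s, forall u, I u} ->
  exists (a b : R) (cs : seq (R * R)),
    let g u := a + b * u + \sum_(c <- cs) c.1 * `|u - c.2| in
    [/\ {in cs, forall c, 0 <= c.1},
        {in z :: s, forall u, f u = g u} &
        forall u, u <= z -> g u = f z + (f z - f y) / (z - y) * (u - z)].
Proof.
elim: s y z => [|z1 s IH] y z.
  move=> _ _; pose m := (f z - f y) / (z - y).
  exists (f z - m * z), m, [::]; split=> // u.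
    by rewrite inE => /eqP->; rewrite big_nil; ring.
  by move=> _; rewrite big_nil -/m; ring.
move=> /andP[yz]; rewrite -/(path _ z (z1 :: s)) => zs sI.
have /andP[zz1 _] := zs.
case: (IH z z1 zs) => [u us|a [b [cs [cs_ge0 g_s g_z1]]]].
  by apply: sI; rewrite in_cons us orbT.
(* The slopes on the two sides of [z]; convexity makes them increase. *)
pose m := (f z - f y) / (z - y); pose m1 := (f z1 - f z) / (z1 - z).
have slope_le : m <= m1.
  have := convex_function_three_points y z z1 (sI y _) (sI z1 _) yz zz1.
  rewrite !inE !eqxx !orbT => /(_ isT isT) h.
  rewrite /m /m1 ler_pdivrMr ?subr_gt0 // mulrAC ler_pdivlMr ?subr_gt0 //.
  lra.
(* This adds [(m1 - m) / 2 * (|u - z| - (u - z))], which vanishes for [u >= z] and lowers the slope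
   from [m1] to [m] on the left of [z]. *)
exists (a + (m1 - m) / 2 * z), (b - (m1 - m) / 2), (((m1 - m) / 2, z) :: cs).
have g'E u : a + (m1 - m) / 2 * z + (b - (m1 - m) / 2) * u +
    \sum_(c <- ((m1 - m) / 2, z) :: cs) c.1 * `|u - c.2| =
    a + b * u + \sum_(c <- cs) c.1 * `|u - c.2|
    + (m1 - m) / 2 * (`|u - z| - (u - z)).
  by rewrite big_cons /=; ring.
have left_z u : u <= z -> a + (m1 - m) / 2 * z + (b - (m1 - m) / 2) * u +
    \sum_(c <- ((m1 - m) / 2, z) :: cs) c.1 * `|u - c.2| =
    f z + m * (u - z).
  move=> uz; rewrite g'E g_z1 ?(le_trans uz (ltW zz1)) // -/m1.
  rewrite ler0_norm ?subr_le0 //.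
  have -> : f z = f z1 - m1 * (z1 - z).
    by rewrite /m1 divfK ?subr_eq0 ?gt_eqF //; ring.
  by field.
split=> //.
- move=> c; rewrite inE => /predU1P[-> /=|/cs_ge0 //].
  by rewrite divr_ge0 ?subr_ge0.
- move=> u; rewrite inE => /predU1P[->|us].
    by rewrite left_z // subrr mulr0 addr0.
  have zu : z < u.
    by have /allP/(_ u us) := order_path_min lt_trans zs.
  by rewrite g'E -g_s // ger0_norm ?subr_ge0 ?ltW // subrr mulr0 addr0.
Qed.

Lemma convex_interpolation (s : seq R) : {in s, forall u, I u} ->
  exists (a b : R) (cs : seq (R * R)),
    {in cs, forall c, 0 <= c.1} /\
    {in s, forall u, f u = a + b * u + \sum_(c <- cs) c.1 * `|u - c.2|}.
Proof.
move=> sI; set s' := sort <=%R (undup s).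
have s'_s : s' =i s by move=> u; rewrite mem_sort mem_undup.
have : sorted <%R s' by rewrite sort_lt_sorted undup_uniq.
case: s' s'_s => [|y [|z s']] s'_s ps.
- by exists 0, 0, [::]; split=> // u; rewrite -s'_s.
- exists (f y), 0, [::]; split=> // u; rewrite -s'_s inE => /eqP->.
  by rewrite big_nil; ring.
- have s'I : {in y :: z :: s', forall u, I u}.
    by move=> u; rewrite s'_s; apply: sI.
  have [a [b [cs [cs_ge0 gs gz]]]] := convex_path_interpolation y z s' ps s'I.
  (* The leftmost point [y] is outside the range of [gs]; there the formula for the left segment
     gives [f y]. *)
  exists a, b, cs; split=> // u; rewrite -s'_s inE => /predU1P[->|/gs //].
  have /andP[yz _] := ps.
  by rewrite gz ?ltW //; field; rewrite subr_eq0 gt_eqF.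
Qed.

(** With [f] replaced by its interpolant, the two vanishing moments remove the affine part, and each
    bend contributes a nonnegative multiple of a sum bounded by the last hypothesis. *)
Lemma convex_weighted_sum_ge0 (ws : seq (R * R)) :
  {in ws, forall p, I p.2} ->
  \sum_(p <- ws) p.1 = 0 ->
  \sum_(p <- ws) p.1 * p.2 = 0 ->
  (forall t, 0 <= \sum_(p <- ws) p.1 * `|p.2 - t|) ->
  0 <= \sum_(p <- ws) p.1 * f p.2.
Proof.
move=> wsI sum_w sum_wz abs_ge0.
have [|a [b [cs [cs_ge0 fE]]]] := convex_interpolation [seq p.2 | p <- ws].
  by move=> _ /mapP[p /wsI Ip ->].
rewrite (eq_big_seq (fun p => p.1 * a + b * (p.1 * p.2) +
   \sum_(c <- cs) c.1 * (p.1 * `|p.2 - c.2|))); last first.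
  move=> p pws; rewrite fE ?map_f // !mulrDr mulr_sumr; congr (_ + _ + _).
    by ring.
  by apply: eq_bigr => c _; ring.
rewrite !big_split /= -mulr_suml -mulr_sumr sum_w sum_wz mul0r mulr0 !add0r.
rewrite exchange_big /= big_seq; apply: sumr_ge0 => c ccs.
by rewrite -mulr_sumr mulr_ge0 ?cs_ge0.
Qed.

End ConvexSums.

(** * Sums over one period and cyclic indices *)

Lemma sum_int_shift1 (V : zmodType) (n : nat) (G : int -> V) :
  (forall i, G (i + n%:Z) = G i) ->
  \sum_(1 <= s < n.+1) G (s%:Z + 1) = \sum_(1 <= s < n.+1) G s%:Z.
Proof.
move=> Gper; rewrite !big_add1 /=; case: n Gper => [|n] Gper.
  by rewrite !big_geq.
rewrite [LHS]big_nat_recr // [RHS]big_nat_recl //= addrC; congr (_ + _).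
  by rewrite -[RHS]Gper; congr G; lia.
by apply: eq_bigr => i _; congr G; lia.
Qed.

(** Induction on [r] in both directions from [0], with [G] general because each unit shift is
    applied to a translate of [G]. *)
Lemma sum_int_shift (V : zmodType) (n : nat) (r : int) (G : int -> V) :
  (forall i, G (i + n%:Z) = G i) ->
  \sum_(1 <= s < n.+1) G (s%:Z + r) = \sum_(1 <= s < n.+1) G s%:Z.
Proof.
elim/int_ind: r G => [|k IH|k IH] G Gper.
- by apply: eq_bigr => s _; rewrite addr0.
- rewrite -[RHS]sum_int_shift1 // -(IH (fun i => G (i + 1))).
    by apply: eq_bigr => s _; congr G; lia.
  by move=> i; rewrite -[RHS]Gper; congr G; lia.
- rewrite -[RHS]IH // -[LHS](sum_int_shift1 _ _ (fun i => G (i - k.+1%:Z))).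
    by apply: eq_bigr => s _; congr G; lia.
  by move=> i; rewrite -[RHS]Gper; congr G; lia.
Qed.

Section CyclicExtension.
Variables (R : realType) (n : nat) (pts : n.-tuple R).

Lemma cyclic_ext_period (i : int) : cyclic_ext pts (i + n%:Z) = cyclic_ext pts i.
Proof. by rewrite /cyclic_ext addrAC modzDr. Qed.

Lemma cyclic_ext_mem (i : int) : (0 < n)%N -> cyclic_ext pts i \in pts.
Proof.
move=> n_gt0; apply: mem_nth; rewrite size_tuple.
have : ((i - 1) %% n%:Z)%Z < n%:Z by rewrite ltz_pmod.
have : 0 <= ((i - 1) %% n%:Z)%Z by rewrite modz_ge0 //; lia.
lia.
Qed.

Lemma sum_cyclic_ext (V : zmodType) (F : R -> V) :
  \sum_(1 <= i < n.+1) F (cyclic_ext pts i%:Z) = \sum_(y <- pts) F y.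
Proof.
rewrite big_add1 /= [RHS](big_nth 0) size_tuple.
apply: eq_big_nat => i /andP[_ lt_in].
congr (F (nth _ _ _)); rewrite modz_small; lia.
Qed.

Lemma sum_norm_cyclic_le (t : R) (r : int) :
  let y i := cyclic_ext pts i - t in
  let S := \sum_(1 <= i < n.+1) y i%:Z in
  \sum_(1 <= s < n.+1) `|S + (y s%:Z - y (s%:Z + r))|
    <= 2 * \sum_(1 <= i < n.+1) `|y i%:Z| + (n%:R - 2) * `|S|.
Proof.
cbv zeta; set y := fun i => cyclic_ext pts i - t.
set S := \sum_(1 <= i < n.+1) y i%:Z.
have sum_y (F : R -> R) :
    \sum_(1 <= i < n.+1) F (y i%:Z) = \sum_(u <- [seq u - t | u <- pts]) F u.
  by rewrite big_map -(sum_cyclic_ext _ (fun u => F (u - t))).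
have := sum_norm_total_sub_le R [seq u - t | u <- pts].
rewrite /= size_map size_tuple -(sum_y id) -/S -!sum_y => popoviciu.
have shift := sum_int_shift _ n r (fun i => `|S - y i|).
apply: (@le_trans _ _ (\sum_(1 <= s < n.+1) (`|y s%:Z| + `|S - y (s%:Z + r)|))).
  apply: ler_sum => s _; rewrite addrCA; exact: ler_normD.
(* By periodicity the shift by [r] disappears from the second sum, which [popoviciu] then bounds. *)
rewrite big_split /= shift; last by move=> i; rewrite /y cyclic_ext_period.
lra.
Qed.

End CyclicExtension.

(** * Membership of the evaluation points in the interval *)

Lemma ex_seq_le_ge (R : realDomainType) (s : seq R) : s != [::] ->
  exists a b, [/\ a \in s, b \in s & {in s, forall y, a <= y <= b}].
Proof.
elim: s => // y [|z s] IH _.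
  by exists y, y; rewrite mem_head; split=> // u; rewrite inE => /eqP->;
    rewrite lexx.
have [//|a [b [a_s b_s ab]]] := IH.
exists (Num.min y a), (Num.max y b); split.
- by rewrite in_cons; case: lerP; rewrite ?eqxx ?a_s ?orbT.
- by rewrite in_cons; case: lerP; rewrite ?eqxx ?b_s ?orbT.
- move=> u; rewrite in_cons ge_min le_max => /predU1P[->|/ab/andP[-> ->]].
    by rewrite lexx.
  by rewrite !orbT.
Qed.

(* Since all [y - a] are nonnegative, their sum is at least [v - a]; hence
   [\sum y + u - v >= n a + u - a >= n a]. *)
Lemma mean_perturbation_ge (R : realFieldType) (s : seq R) (a u v : R) :
  {in s, forall y, a <= y} -> u \in s -> v \in s ->
  a <= (\sum_(y <- s) y) / (size s)%:R + (u - v) / (size s)%:R.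
Proof.
move=> a_le us vs.
have n_gt0 : 0 < (size s)%:R :> R by rewrite ltr0n; case: s us {a_le vs}.
rewrite -mulrDl ler_pdivlMr //.
have : v - a <= \sum_(y <- s) (y - a).
  rewrite (perm_big _ (perm_to_rem vs)) big_cons lerDl big_seq.
  by apply: sumr_ge0 => y /mem_rem /a_le; rewrite subr_ge0.
rewrite big_split /= sumrN big_const_seq count_predT iter_addr_0 -mulr_natr.
have := a_le _ us; lra.
Qed.

Lemma interval_mean_perturbation (R : realType) (I : set R) (s : seq R)
    (u v : R) :
  is_interval I -> {in s, forall y, I y} -> u \in s -> v \in s ->
  I ((\sum_(y <- s) y) / (size s)%:R + (u - v) / (size s)%:R).
Proof.
move=> I_interval sI us vs.
have [|a [b [a_s b_s ab]]] := ex_seq_le_ge R s; first by case: s us {sI vs}.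
apply: (I_interval a b); [exact: sI|exact: sI|apply/andP; split].
  by apply: mean_perturbation_ge => // y /ab/andP[].
(* The upper bound is the lower bound for the negated list. *)
rewrite -lerN2.
have := mean_perturbation_ge R [seq - y | y <- s] (- b) (- u) (- v).
rewrite size_map big_map sumrN !mem_map; try exact: oppr_inj.
rewrite -opprD !mulNr -opprD; apply=> //.
by move=> _ /mapP[y /ab/andP[_ yb] ->]; rewrite lerN2.
Qed.

Theorem mainTheorem3 (R : realType) (I : set R) (f : R -> R)
    (I_interval : is_interval I)
    (f_convex : @convex_function R R^o I f)
    (n : nat) (n_gt0 : (0 < n)%N) (pts : n.-tuple R)
    (pts_in_I : forall y : R, y \in pts -> I y)
    (r : int) :
  let x : int -> R := cyclic_ext pts in
  let xbar : R := (\sum_(1 <= i < n.+1) x i%:Z) / n%:R in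
  2 * (\sum_(1 <= i < n.+1) f (x i%:Z)) + n%:R * (n%:R - 2) * f xbar >=
  n%:R * (\sum_(1 <= s < n.+1) f (xbar + (x s%:Z - x (s%:Z + r)) / n%:R)).
Proof.
cbv zeta; set x := cyclic_ext pts; set xbar := (_ / n%:R).
have n_pos : 0 < n%:R :> R by rewrite ltr0n.
have n_neq0 : n%:R != 0 :> R by rewrite gt_eqF.
pose z (s : nat) := xbar + (x s%:Z - x (s%:Z + r)) / n%:R.
(* Weights chosen so that the weighted sum of [f] is the left side of the informal inequality minus
   its right side. *)
pose ws := [seq (2 : R, x i%:Z) | i : nat <- index_iota 1 n.+1] ++
  (n%:R * (n%:R - 2), xbar) :: [seq (- n%:R, z s) | s <- index_iota 1 n.+1].
have sum_ws (F : R -> R) : \sum_(p <- ws) p.1 * F p.2 =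
    2 * (\sum_(1 <= i < n.+1) F (x i%:Z)) + n%:R * (n%:R - 2) * F xbar
    - n%:R * \sum_(1 <= s < n.+1) F (z s).
  by rewrite big_cat big_cons !big_map /= -!mulr_sumr mulNr addrA.
rewrite -subr_ge0 -sum_ws.
(* Arbitrary indices cover every [z s], and also [xbar] itself when [i = j]. *)
have z_in (i j : int) : I (xbar + (x i - x j) / n%:R).
  have -> : xbar = (\sum_(y <- pts) y) / n%:R.
    by rewrite -(sum_cyclic_ext _ _ pts _ id).
  have := interval_mean_perturbation _ _ pts (x i) (x j) I_interval pts_in_I.
  by rewrite size_tuple; apply; exact: cyclic_ext_mem.
have sum_const (c : R) : \sum_(1 <= i < n.+1) c = n%:R * c.
  by rewrite sumr_const_nat subSS subn0 mulr_natl.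
have sum_x : \sum_(1 <= i < n.+1) x i%:Z = n%:R * xbar.
  by rewrite mulrC divfK.
apply: (convex_weighted_sum_ge0 _ _ _ f_convex).
- move=> p; rewrite mem_cat inE => /or3P[/mapP[i _ ->]|/eqP->|/mapP[s _ ->]] /=.
  + exact/pts_in_I/cyclic_ext_mem.
  + by have := z_in 0 0; rewrite subrr mul0r addr0.
  + exact: z_in.
(* The total weight is [2 n + n (n - 2) - n n = 0]. *)
- rewrite (eq_bigr (fun p => p.1 * 1)) ?(sum_ws (fun=> 1)) ?sum_const.
    by ring.
  by move=> p _; rewrite mulr1.
- rewrite (sum_ws id) sum_x.
  (* The differences [x s - x (s + r)] cancel over a full period. *)
  have -> : \sum_(1 <= s < n.+1) z s = n%:R * xbar.
    rewrite big_split /= sum_const -mulr_suml big_split /= sumrN.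
    rewrite (sum_int_shift _ n r x) ?subrr ?mul0r ?addr0 //.
    exact: cyclic_ext_period.
  by ring.
- move=> t; rewrite (sum_ws (fun u => `|u - t|)) subr_ge0.
  (* With [y i = x i - t], the total is [S = n (xbar - t)], and scaling by [n] gives
     [n |z s - t| = |S + (y s - y (s + r))|]. *)
  have := sum_norm_cyclic_le _ _ pts t r.
  rewrite /= big_split /= sum_const -/x sum_x mulrN -mulrBr normrM.
  rewrite (ger0_norm (ltW n_pos)) mulrA [(n%:R - 2) * _]mulrC.
  congr (_ <= _); rewrite mulr_sumr; apply: eq_bigr => s _.
  rewrite -{2}(ger0_norm (ltW n_pos)) -normrM /z; congr `|_|.
  by field.
Qed.
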